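(* Let $X=(V,E,F)$ be an oriented net, $f:V\to\mathbb{R}^3$ an immersion and $n:F\to\mathbb{S}^2$ unit vectors assigned to the faces. (1) $(X,f,n)$ is an A-minimal surface if and only if it is a face-edge-constraint minimal net with vanishing integrated mean curvature on edges, i.e. $\mathbf{H}_{ij}=0$ for all edges $e_{ij}$. (2) $(X,f,n)$ is a C-minimal surface if and only if it is a classical face-edge-constraint net that is minimal.
   Context: $\mathbb{R}^3$ is identified with the imaginary quaternions. Oriented net: $X=(V,E,F)$ is a connected cell complex decomposing an oriented surface into polygonal faces; two adjacent faces share exactly one edge, and every edge is shared by exactly two faces. The edges of each face carry its boundary orientation. For adjacent faces $\Delta_i,\Delta_j$, $df_{ij}$ is the edge vector of the common edge $e_{ij}$, oriented as in $\Delta_i$ (so $df_{ij}=-df_{ji}$). Face-edge-constraint net: $(X,f,n)$ with $n_i+n_j\perp df_{ij}$ for all adjacent faces. Throughout it is assumed that $df_{ij}\ne0$, that $n_i,n_j$ are not parallel to $df_{ij}$, and that the dihedral angle $\theta_{ij}$ lies in $(-\pi,\pi)$, where $\theta_{ij}$ is the angle of the right-handed rotation about $df_{ij}$ taking the half-plane $\mathbb{R}\,df_{ij}+\mathbb{R}_{>0}n_i$ to $\mathbb{R}\,df_{ij}+\mathbb{R}_{>0}n_j$. Integrated mean curvature: $\mathbf{H}_{ij}=\tfrac12|df_{ij}|\tan\tfrac{\theta_{ij}}2$, and $\mathbf{H}_i=\sum_j\mathbf{H}_{ij}$ over adjacent faces. A face-edge-constraint net is minimal if $\mathbf{H}_i=0$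 for all faces. It is classical if all faces are planar and $n_i$ is the normal of the face $\Delta_i$. A-minimal: $df_{ij}\times(n_i-n_j)=0$ and $\langle n_i+n_j,df_{ij}\rangle=0$ for all edges $e_{ij}$. C-minimal: all faces are planar, $n_i$ is the normal of $\Delta_i$, and $\sum_j|df_{ij}|\tan\frac{\theta_{ij}}2=0$ for every face $\Delta_i$, where $j$ runs over adjacent faces and $\theta_{ij}$ is the (signed, dihedral) angle between $n_i$ and $n_j$. *)

(* Defs.v *)
From Stdlib Require Import Relation_Operators.
From mathcomp Require Import all_boot all_order all_algebra.
From mathcomp Require Import all_classical all_reals all_analysis.

Set Implicit Arguments.
Unset Strict Implicit.
Unset Printing Implicit Defensive.

Import Order.TTheory GRing.Theory Num.Theory.
Local Open Scope classical_set_scope.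
Local Open Scope ring_scope.

Definition next_side (F : Type) (deg : F -> nat) (e : {i : F & 'I_(deg i)}) :
    {i : F & 'I_(deg i)} :=
  Tagged (fun i => 'I_(deg i)) (ordS (tagged e)).

(** An oriented cell decomposition given by its faces: the boundary of the face
    [i] is a polygon with [deg i] sides, the [k]-th one being the edge oriented
    as in [i] (an "oriented edge") that starts at [corner k].  [opp] glues the
    sides in pairs; an unoriented edge is a pair [{e, opp e}].  The surface may
    be non-compact. *)
Record oriented_net := OrientedNet {
  vertex : Type;
  face : Type;
  deg : face -> nat;
  corner : forall i : face, 'I_(deg i) -> vertex;
  opp : {i : face & 'I_(deg i)} -> {i : face & 'I_(deg i)};

  deg_ge3 : forall i, (3 <= deg i)%N;
  oppK : involutive opp;
  (* [opp e] is the same edge with the reversed orientation: it starts where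
     [e] ends. *)
  corner_opp : forall e,
    corner (tagged (opp e)) = corner (tagged (next_side e));
  (* The two faces sharing an edge are distinct. *)
  opp_face : forall e, tag (opp e) <> tag e;
  (* Two adjacent faces share only one edge. *)
  opp_uniq : forall e e', tag e = tag e' -> tag (opp e) = tag (opp e') ->
    e = e';
  corner_surj : forall v, exists i (k : 'I_(deg i)), corner k = v;
  (* The oriented edges starting at a vertex form a single orbit under the
     rotation around that vertex.  Applied to [e] and its predecessor, this
     also makes the orbit finite, so that vertex links are circles. *)
  corner_orbit : forall e e' : {i : face & 'I_(deg i)},
    corner (tagged e) = corner (tagged e') ->
    exists m : nat, e' = iter m (fun d => next_side (opp d)) e;
  net_connected : forall i j, clos_refl_trans face
    (fun i' j' => exists e, tag e = i' /\ tag (opp e) = j') i j }.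

Definition oedge (X : oriented_net) := {i : face X & 'I_(deg i)}.

Section Space.
Variable R : realType.
Implicit Types u v w x : 'rV[R]_3.

Definition dot u v : R := (u *m v^T) 0 0.

(* The norm [`|u|] of the library is the sup norm on row vectors. *)
Definition enorm u : R := Num.sqrt (dot u u).

(* Coordinate indices are added modulo 3. *)
Definition cross u v : 'rV[R]_3 :=
  \row_(k < 3) (u 0 (k + 1) * v 0 (k + 2) - u 0 (k + 2) * v 0 (k + 1)).

(* Right-handed rotation by the angle [t] about the line spanned by [w],
   oriented by [w] (Rodrigues' formula). *)
Definition rotation w (t : R) x : 'rV[R]_3 :=
  let a := (enorm w)^-1 *: w in
  cos t *: x + sin t *: cross a x + ((1 - cos t) * dot a x) *: a.

Definition half_plane w u : set 'rV[R]_3 :=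
  [set x | exists a b : R, 0 < b /\ x = a *: w + b *: u].

Definition plane (p m : 'rV[R]_3) : set 'rV[R]_3 := [set x | dot (x - p) m = 0].

End Space.

Section Nets.
Variables (R : realType) (X : oriented_net).
Variables (f : vertex X -> 'rV[R]_3) (n : face X -> 'rV[R]_3).
Implicit Types (e : oedge X) (i : face X).

(* For an oriented edge [e] of the face [i], with [j] the face on its other
   side, the subscript [ij] is rendered by [e]; as two adjacent faces share
   exactly one edge, [e] and [(i, j)] determine each other. *)
Definition lface e : face X := tag e.
Definition rface e : face X := tag (opp e).

Definition df e : 'rV[R]_3 :=
  f (corner (tagged (next_side e))) - f (corner (tagged e)).

Definition immersion := forall e, df e != 0.

(* The value 0 is used if there is no such angle; there is exactly one when
   neither normal is parallel to [df e != 0]. *)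
Definition dihedral_angle e : R :=
  xget 0 [set t | - pi < t <= pi /\
    rotation (df e) t @` half_plane (df e) (n (lface e))
      = half_plane (df e) (n (rface e))].

Definition normals_not_parallel := forall e (c : R),
  n (lface e) != c *: df e /\ n (rface e) != c *: df e.

Definition dihedral_angles_open := forall e, - pi < dihedral_angle e < pi.

Definition mean_curv_edge e : R :=
  2^-1 * enorm (df e) * tan (dihedral_angle e / 2).

Definition mean_curv_face i : R :=
  \sum_(k < deg i) mean_curv_edge (Tagged (fun i => 'I_(deg i)) k).

Definition face_edge_constraint :=
  forall e, dot (n (lface e) + n (rface e)) (df e) = 0.

Definition minimal := forall i, mean_curv_face i = 0.

Definition planar_face i := exists p m : 'rV[R]_3,
  m != 0 /\ forall k : 'I_(deg i), plane p m (f (corner k)).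

(* The choice between the two unit normals of a planar face is left free. *)
Definition face_normal i := exists p : 'rV[R]_3,
  forall k : 'I_(deg i), plane p (n i) (f (corner k)).

Definition planar_with_normals := forall i, planar_face i /\ face_normal i.

Definition classical_net := face_edge_constraint /\ planar_with_normals.

Definition A_minimal := forall e,
  cross (df e) (n (lface e) - n (rface e)) = 0 /\
  dot (n (lface e) + n (rface e)) (df e) = 0.

(* Signed angle between the normals of two adjacent planar faces, measured
   about their common edge. *)
Definition normal_angle e : R :=
  xget 0 [set t | - pi < t <= pi /\
    rotation (df e) t (n (lface e)) = n (rface e)].

Definition C_minimal := planar_with_normals /\
  forall i, \sum_(k < deg i)
    (let e : oedge X := Tagged (fun i => 'I_(deg i)) k in
     enorm (df e) * tan (normal_angle e / 2)) = 0.

End Nets.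

(* Main.v *)
Require Import Defs.
From mathcomp Require Import all_boot all_order all_algebra.
From mathcomp Require Import all_classical all_reals all_analysis.
From mathcomp Require Import ring lra.
Import Order.TTheory GRing.Theory Num.Theory.
Local Open Scope ring_scope.

(** Fix an edge vector [w = df e] and the unit normals [u], [v] of the two faces
    along it.  The rotations about [w] are linear and fix [w], so the rotation
    by [t] maps the half-plane of [u] onto that of [v] exactly when the single
    vector [rotation w t u] lies in the half-plane of [v]
    ([image_rotation_half_planeP]).  Such a [t] exists when neither normal is
    parallel to [w] ([exists_rotation_half_plane]), hence the dihedral angle,
    defined by choice, does have the property that defines it.

    For A-minimal nets: as the dihedral angle lies strictly between [- pi] and
    [pi] and [w] is nonzero, the integrated mean curvature of the edge vanishes
    iff the angle is 0, i.e. iff [u] already lies in the half-plane of [v]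
    ([mean_curv_edge_eq0P]).  When [u + v] is orthogonal to [w], the components
    of [u] and [v] along [w] are opposite, hence of equal size, and so are the
    lengths of their components orthogonal to [w], because [u] and [v] are unit
    vectors.  Lying in the same half-plane then forces these orthogonal
    components to be equal, i.e. [u - v] to be parallel to [w]
    ([cross_sub_eq0_half_planeP]).  A net whose edges all have zero curvature
    is trivially minimal.

    For C-minimal nets: the normal of a planar face is orthogonal to all the
    edges of that face, and every edge lies in both of its faces, which gives
    the face-edge constraint.  Two unit vectors orthogonal to [w] that span the
    same half-plane are equal, so the angle between the normals is the dihedral
    angle ([normal_angle_dihedral]), and the two sums defining minimality differ
    by the factor 1/2. *)

(** * Vectors of the space *)

Section Vectors.
Set Implicit Arguments.
Unset Strict Implicit.
Variable R : realType.
Implicit Types a p q u v w x : 'rV[R]_3.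

Lemma row3P u v :
  u 0 0 = v 0 0 -> u 0 1 = v 0 1 -> u 0 2%:R = v 0 2%:R -> u = v.
Proof.
move=> h0 h1 h2; apply/rowP => -[[|[|[|//]]] hk].
- by rewrite (_ : Ordinal hk = 0) //; apply: val_inj.
- by rewrite (_ : Ordinal hk = 1) //; apply: val_inj.
- by rewrite (_ : Ordinal hk = 2%:R) //; apply: val_inj.
Qed.

Lemma dotE u v :
  dot u v = u 0 0 * v 0 0 + u 0 1 * v 0 1 + u 0 2%:R * v 0 2%:R.
Proof.
rewrite /dot !mxE !big_ord_recr big_ord0 /= !mxE add0r.
by congr (u _ _ * v _ _ + u _ _ * v _ _ + u _ _ * v _ _); apply: val_inj.
Qed.

Lemma crossE u v :
  (cross u v 0 0 = u 0 1 * v 0 2%:R - u 0 2%:R * v 0 1) *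
  (cross u v 0 1 = u 0 2%:R * v 0 0 - u 0 0 * v 0 2%:R) *
  (cross u v 0 2%:R = u 0 0 * v 0 1 - u 0 1 * v 0 0).
Proof.
by split; [split|]; rewrite !mxE;
  congr (u _ _ * v _ _ - u _ _ * v _ _); apply: val_inj.
Qed.

Ltac coordinates := rewrite ?(dotE, crossE, mxE).
Ltac by_coordinates := apply: row3P; coordinates; ring.

Lemma dotC u v : dot u v = dot v u.
Proof. by coordinates; ring. Qed.

Lemma dotDl u v w : dot (u + v) w = dot u w + dot v w.
Proof. by coordinates; ring. Qed.

Lemma dotZl c u w : dot (c *: u) w = c * dot u w.
Proof. by coordinates; ring. Qed.

Lemma dotDr w u v : dot w (u + v) = dot w u + dot w v.
Proof. by coordinates; ring. Qed.

Lemma dotZr c w u : dot w (c *: u) = c * dot w u.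
Proof. by coordinates; ring. Qed.

Lemma dotNr w u : dot w (- u) = - dot w u.
Proof. by coordinates; ring. Qed.

Lemma dot_cross_self a u : dot (cross a u) a = 0.
Proof. by coordinates; ring. Qed.

Lemma dot_crossr_self a u : dot (cross a u) u = 0.
Proof. by coordinates; ring. Qed.

Lemma crossZl c u v : cross (c *: u) v = c *: cross u v.
Proof. by_coordinates. Qed.

Lemma crossZr c u v : cross u (c *: v) = c *: cross u v.
Proof. by_coordinates. Qed.

Lemma crossxx u : cross u u = 0.
Proof. by_coordinates. Qed.

Lemma cross_cross u v w :
  cross u (cross v w) = dot u w *: v - dot u v *: w.
Proof. by_coordinates. Qed.

Lemma dot_cross u v :
  dot (cross u v) (cross u v) = dot u u * dot v v - dot u v ^+ 2.
Proof. by coordinates; ring. Qed.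

Lemma dot_ge0 u : 0 <= dot u u.
Proof. by rewrite dotE -!expr2 !addr_ge0 ?sqr_ge0. Qed.

Lemma dot_gt0 u : u != 0 -> 0 < dot u u.
Proof.
move=> u0; rewrite lt_def dot_ge0 andbT; apply: contra u0.
rewrite dotE -!expr2 !paddr_eq0 ?addr_ge0 ?sqr_ge0// !sqrf_eq0.
move=> /andP[/andP[/eqP h0 /eqP h1] /eqP h2].
by apply/eqP/row3P; rewrite !mxE.
Qed.

Lemma enorm_neq0 u : u != 0 -> enorm u != 0.
Proof. by move=> /dot_gt0 h; rewrite gt_eqF ?sqrtr_gt0. Qed.

Lemma dot_enorm u : dot u u = enorm u ^+ 2.
Proof. by rewrite sqr_sqrtr ?dot_ge0. Qed.

Lemma dot_axis w :
  w != 0 -> dot ((enorm w)^-1 *: w) ((enorm w)^-1 *: w) = 1.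
Proof.
by move=> /enorm_neq0 w0; rewrite dotZl dotZr dot_enorm; field.
Qed.

Lemma axis_scaled w : w != 0 -> w = enorm w *: ((enorm w)^-1 *: w).
Proof. by move=> w0; rewrite scalerA mulfV ?enorm_neq0// scale1r. Qed.

Lemma cross_eq0_parallel w u : w != 0 -> cross w u = 0 ->
  u = (dot w u / dot w w) *: w.
Proof.
move=> /dot_gt0/lt0r_neq0 w0 wu; have := cross_cross w w u.
rewrite wu (_ : cross w 0 = 0); last by by_coordinates.
move=> /esym/subr0_eq h; rewrite mulrC -scalerA h scalerA mulVf//.
by rewrite scale1r.
Qed.

(** Up to positive factors, [p] and [cross a p] are the axes of the plane
    orthogonal to [a], and this gives the coordinates of [q] on them: the cosine
    and the sine of the angle from [p] to [q], scaled by the lengths. *)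
Lemma orthogonal_frame_expansion a p q :
  dot a a = 1 -> dot a p = 0 -> dot a q = 0 ->
  dot p p *: q = dot p q *: p + dot (cross a p) q *: cross a p.
Proof.
move=> aa ap aq.
(* [cross p q] is parallel to [a] because [a] is orthogonal to [p] and [q]. *)
have pq : cross p q = dot (cross a p) q *: a.
  have h : cross a (cross p q) = 0.
    by rewrite cross_cross ap aq !scale0r subrr.
  have a0 : a != 0.
    by apply/eqP => a0; move/eqP: aa; rewrite a0 dotE !mxE !mulr0 !addr0 eq_sym oner_eq0.
  rewrite {1}(cross_eq0_parallel a0 h) aa divr1; congr (_ *: _).
  by coordinates; ring.
(* Expanding [cross (cross p q) p] as a double cross product concludes. *)
have <- : cross (cross p q) p = dot (cross a p) q *: cross a p.
  by rewrite pq crossZl.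
by_coordinates.
Qed.

Lemma orthogonal_frame_pythagoras a p q :
  dot a a = 1 -> dot a p = 0 -> dot a q = 0 ->
  dot p q ^+ 2 + dot (cross a p) q ^+ 2 = dot p p * dot q q.
Proof.
move=> aa ap aq; rewrite -dotZl (orthogonal_frame_expansion aa ap aq).
by rewrite dotDl !dotZl !expr2.
Qed.

(** * Angles *)

Lemma exists_angle (c s : R) : c ^+ 2 + s ^+ 2 = 1 ->
  exists t : R, [/\ - pi < t <= pi, cos t = c & sin t = s].
Proof.
move=> cs.
have c1 : -1 <= c <= 1.
  by have s2 := sqr_ge0 s; apply/andP; split; nra.
have cosc : cos (acos c) = c by rewrite acosK// in_itv.
have sinc : sin (acos c) = `|s|.
  by rewrite sin_acos// -sqrtr_sqr -cs addrAC subrr add0r.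
have [s0|s0] := leP 0 s.
  exists (acos c); split => //; last by rewrite sinc ger0_norm.
  by rewrite acos_lepi// andbT (lt_le_trans _ (acos_ge0 c1))// oppr_lt0 pi_gt0.
(* Here [s < 0] excludes [c = -1], so [- acos c] stays above [- pi]. *)
exists (- acos c); split; last 2 first.
- by rewrite cosN.
- by rewrite sinN sinc ltr0_norm ?opprK.
have -> : - acos c <= pi.
  by rewrite (@le_trans _ _ 0)// ?oppr_le0 ?acos_ge0 ?pi_ge0.
rewrite andbT ltrN2 acos_ltpi//.
case/andP: c1 => c1 ->; rewrite lt_neqAle c1 !andbT.
by apply/eqP => c1'; move: cs; rewrite -c1'; nra.
Qed.

Lemma sin_eq0_small (t : R) : - pi < t < pi -> sin t = 0 -> t = 0.
Proof.
move=> /andP[tl tu] st; apply/eqP/negPn/negP => /lt_total/orP[t0|t0].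
- have : 0 < sin (- t) by apply: sin_gt0_pi; rewrite oppr_gt0 t0 ltrNl.
  by rewrite sinN st oppr0 ltxx.
- by have : 0 < sin t by [apply: sin_gt0_pi; rewrite t0]; rewrite st ltxx.
Qed.

Lemma tan_half_eq0 (t : R) : - pi < t < pi -> tan (t / 2) = 0 -> t = 0.
Proof.
move=> t_pi /eqP; rewrite /tan mulf_eq0 invr_eq0 => /orP[|] /eqP.
  move=> /sin_eq0_small h; suff : t / 2 = 0 by lra.
  by apply: h; have := pi_gt0 R; lra.
have /lt0r_neq0/eqP : 0 < cos (t / 2) by [apply: cos_gt0_pihalf; lra].
by [].
Qed.

(** * Rotations about an axis and half-planes bounded by it *)

Lemma rotation_axis_combination w t (c b : R) u : w != 0 ->
  rotation w t (c *: w + b *: u) = c *: w + b *: rotation w t u.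
Proof.
move=> w0; rewrite /rotation.
set a := (enorm w)^-1 *: w.
have aa : dot a a = 1 by apply: dot_axis.
rewrite (axis_scaled w0) -/a.
clearbody a; rewrite dotDr !dotZr aa mulr1.
by by_coordinates.
Qed.

Lemma half_plane_eqP w u v :
  half_plane w u = half_plane w v <-> half_plane w v u.
Proof.
split=> [<-|[c [b [b0 ->]]]]; first by exists 0, 1; rewrite scale0r add0r scale1r.
apply/seteqP; split=> x [x1 [x2 [x20 ->]]].
  exists (x1 + x2 * c), (x2 * b); split; first exact: mulr_gt0.
  by rewrite scalerDr !scalerA addrA -scalerDl.
exists (x1 - x2 / b * c), (x2 / b); split; first exact: divr_gt0.
rewrite scalerDr !scalerA divfK ?gt_eqF//.
by rewrite addrA -scalerDl subrK.
Qed.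

Lemma image_rotation_half_plane w t u : w != 0 ->
  (rotation w t @` half_plane w u)%classic = half_plane w (rotation w t u).
Proof.
move=> w0; apply/seteqP; split=> x.
  move=> [_ [c [b [b0 ->]]] <-]; exists c, b; split=> //.
  exact: rotation_axis_combination.
move=> [c [b [b0 ->]]]; exists (c *: w + b *: u); first by exists c, b.
exact: rotation_axis_combination.
Qed.

(** Reduces an equality of sets, as in the definition of the dihedral angle, to
    the position of one vector. *)
Lemma image_rotation_half_planeP w t u v : w != 0 ->
  (rotation w t @` half_plane w u = half_plane w v)%classic <->
  half_plane w v (rotation w t u).
Proof. by move=> w0; rewrite image_rotation_half_plane//; apply: half_plane_eqP. Qed.

(** The components [p] of [u] and [q] of [v] orthogonal to the axis are nonzero,
    and the angle from [p] to [q] works: it turns [p] into a positive multiple of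
    [q], and the component of [u] along the axis only adds a multiple of [w]. *)
Lemma exists_rotation_half_plane w u v :
  w != 0 -> (forall c, u != c *: w) -> (forall c, v != c *: w) ->
  exists t, - pi < t <= pi /\ half_plane w v (rotation w t u).
Proof.
move=> w0 uw vw; have aa := dot_axis w0; rewrite /rotation.
set a := (enorm w)^-1 *: w in aa *.
pose perp x := x - dot a x *: a.
have perpE x : x = perp x + dot a x *: a by rewrite subrK.
have a_perp x : dot a (perp x) = 0.
  by rewrite /perp dotDr dotNr dotZr aa mulr1 subrr.
have perp_neq0 x : (forall c, x != c *: w) -> perp x != 0.
  by move=> h; rewrite subr_eq0 /a scalerA.
have := perp_neq0 _ vw; have := perp_neq0 _ uw.
have := perpE v; have := perpE u; have := a_perp v; have := a_perp u.
set p := perp u; set q := perp v => ap aq uE vE p0 q0.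
have P0 := dot_gt0 p0; have Q0 := dot_gt0 q0.
pose N := enorm p * enorm q.
have N0 : 0 < N by rewrite mulr_gt0// sqrtr_gt0.
have [|t [t_pi ct st]] := @exists_angle (dot p q / N) (dot (cross a p) q / N).
  rewrite !expr_div_n -mulrDl (orthogonal_frame_pythagoras aa ap aq).
  rewrite !dot_enorm -exprMn mulfV//.
  by rewrite expf_neq0// gt_eqF.
exists t; split=> //; rewrite ct st.
(* The rotated vector is [dot a u *: a + (dot p p / N) *: q]; the coefficients
   come from substituting [q = v - dot a v *: a]. *)
exists ((dot a u - dot p p / N * dot a v) / enorm w), (dot p p / N).
split; first exact: divr_gt0.
rewrite -[X in _ = X + _]scalerA -/a.
have expansion : (dot p p / N) *: q =
    (dot p q / N) *: p + (dot (cross a p) q / N) *: cross a p.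
  rewrite ![_ / N]mulrC -!scalerA -scalerDr.
  by rewrite (orthogonal_frame_expansion aa ap aq).
have cross_au : cross a u = cross a p.
  by rewrite uE; by_coordinates.
rewrite cross_au {1}uE {2}vE [X in _ = _ + X]scalerDr expansion.
move: (dot a u) (dot a v) (dot p p / N) (dot p q / N) => alpha beta r c.
move: (dot (cross a p) q / N) (cross a p) => s ap'.
by by_coordinates.
Qed.

Lemma rotation0 w u : rotation w 0 u = u.
Proof. by rewrite /rotation cos0 sin0 subrr mul0r !scale0r !addr0 scale1r. Qed.

Lemma dot_rotation_axis w t u : w != 0 -> dot w (rotation w t u) = dot w u.
Proof.
move=> w0; have aa := dot_axis w0; rewrite /rotation.
set a := (enorm w)^-1 *: w in aa *.
rewrite (axis_scaled w0) -/a.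
clearbody a; rewrite !dotZl !dotDr !dotZr aa.
by rewrite (dotC a (cross a u)) dot_cross_self; ring.
Qed.

Lemma dot_rotation_orthogonal w t u : w != 0 -> dot w u = 0 ->
  dot (rotation w t u) (rotation w t u) = dot u u.
Proof.
move=> w0 wu; have aa := dot_axis w0; rewrite /rotation.
have := dotZl (enorm w)^-1 w u; rewrite wu mulr0.
set a := (enorm w)^-1 *: w in aa *; clearbody a => au.
have crossau : dot (cross a u) (cross a u) = dot u u.
  by rewrite dot_cross aa au mul1r expr0n subr0.
rewrite au mulr0 scale0r addr0 !(dotDl, dotDr, dotZl, dotZr) crossau.
rewrite (dotC u) !dot_crossr_self -[RHS]mul1r -(cos2Dsin2 t); ring.
Qed.

(** A half-plane bounded by the axis contains only one unit vector orthogonal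
    to the axis, and the rotation keeps [u] unit and orthogonal to [w]. *)
Lemma rotation_half_plane_orthogonalP w t u v :
  w != 0 -> dot w u = 0 -> dot w v = 0 -> dot u u = 1 -> dot v v = 1 ->
  half_plane w v (rotation w t u) <-> rotation w t u = v.
Proof.
move=> w0 wu wv uu vv; split=> [[c [b [b0 rot]]]|->]; last first.
  by exists 0, 1; rewrite scale0r add0r scale1r.
have := dot_rotation_orthogonal t w0 wu; have := dot_rotation_axis t u w0.
rewrite rot wu dotDr !dotZr wv mulr0 addr0 => /eqP.
rewrite mulf_eq0 (gt_eqF (dot_gt0 w0)) orbF => /eqP ->.
rewrite scale0r add0r dotZl dotZr uu vv mulr1 => bb.
have -> : b = 1 by nra.
by rewrite scale1r.
Qed.

(** The rotation moves [u] by [sin t] in the direction [cross w u], which is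
    orthogonal to the plane spanned by [w] and [u]; an image of [u] in that plane
    forces this displacement to vanish. *)
Lemma sin_rotation_half_plane_eq0 w t u :
  w != 0 -> (forall c, u != c *: w) ->
  half_plane w u (rotation w t u) -> sin t = 0.
Proof.
move=> w0 uw [c [b [_]]]; rewrite /rotation => /(congr1 (dot (cross w u))).
rewrite crossZl !(dotDr, dotZr) dot_crossr_self dot_cross_self !mulr0.
rewrite add0r !addr0 => /eqP; rewrite !mulf_eq0 invr_eq0.
rewrite (negbTE (enorm_neq0 w0)) /= => /orP[/eqP//|].
have wu : cross w u != 0.
  apply/eqP => /(cross_eq0_parallel w0) /eqP.
  by rewrite (negbTE (uw _)).
by rewrite (gt_eqF (dot_gt0 wu)).
Qed.

(** If [u = c *: w + b *: v], the hypothesis on [u + v] makes the components of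
    [u] and [v] along [w] opposite, so the components orthogonal to [w] have equal
    lengths; their ratio is [b > 0], hence [b = 1]. *)
Lemma cross_sub_eq0_half_planeP w u v :
  w != 0 -> (forall c, v != c *: w) -> dot u u = 1 -> dot v v = 1 ->
  dot (u + v) w = 0 ->
  cross w (u - v) = 0 <-> half_plane w v u.
Proof.
move=> w0 vw uu vv uvw; split.
  move=> /(cross_eq0_parallel w0)/eqP; rewrite subr_eq => /eqP uE.
  by exists (dot w (u - v) / dot w w), 1; rewrite scale1r.
move=> [c [b [b0 uE]]].
have wv : cross w v != 0.
  apply/eqP => /(cross_eq0_parallel w0) /eqP.
  by rewrite (negbTE (vw _)).
have W0 := dot_gt0 wv.
have lagrange : dot (cross w v) (cross w v) = dot w w - dot v w ^+ 2.
  by rewrite dot_cross vv mulr1 (dotC w).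
(* Eliminating [c] between [dot (u + v) w = 0] and [dot u u = 1] leaves
   [(1 + b) * (1 - b) * dot (cross w v) (cross w v) = 0]. *)
have b1 : b = 1.
  have : (1 - b) * dot (cross w v) (cross w v) = 0.
    move: uvw uu; rewrite lagrange uE !(dotDl, dotDr, dotZl, dotZr) vv.
    rewrite (dotC w v); move: (dot w w) (dot v w) => W d h1 h2.
    have b2 : 1 + b != 0 by rewrite gt_eqF// addr_gt0.
    apply: (mulfI b2); rewrite mulr0.
    have h3 : c * W = - (1 + b) * d by lra.
    have h4 : c * (c * W) + 2 * b * c * d + b ^+ 2 = 1 by lra.
    have h5 : (c * W) ^+ 2 + 2 * b * (c * W) * d + b ^+ 2 * W = W.
      by move: (congr1 (fun z => z * W) h4); rewrite /= mul1r => h; rewrite -[RHS]h; ring.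
    by move: h5; rewrite h3 => h5; lra.
  by move/eqP; rewrite mulf_eq0 (gt_eqF W0) orbF subr_eq0 => /eqP.
by rewrite uE b1 scale1r addrK crossZr crossxx scaler0.
Qed.

End Vectors.

(** * Edges and faces of the net *)

Section Nets.
Set Implicit Arguments.
Unset Strict Implicit.
Variables (R : realType) (X : oriented_net).
Variables (f : vertex X -> 'rV[R]_3) (n : face X -> 'rV[R]_3).
Implicit Types (e : oedge X) (i : face X).

Lemma df_opp e : df f (Defs.opp e) = - df f e.
Proof. by rewrite /df -corner_opp oppK corner_opp opprB. Qed.

Hypothesis f_immersion : immersion f.
Hypothesis n_unit : forall i, enorm (n i) = 1.

Let n_dot i : dot (n i) (n i) = 1.
Proof. by rewrite dot_enorm n_unit expr1n. Qed.

Section Dihedral.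
Hypothesis n_not_parallel : normals_not_parallel f n.
Hypothesis theta_open : dihedral_angles_open f n.

(** The default value in the definition of the dihedral angle is never reached,
    because a suitable angle exists. *)
Lemma dihedral_angleP e :
  half_plane (df f e) (n (rface e))
    (rotation (df f e) (dihedral_angle f n e) (n (lface e))).
Proof.
have [t [t_pi ht]] := exists_rotation_half_plane (f_immersion e)
  (fun c => (n_not_parallel e c).1) (fun c => (n_not_parallel e c).2).
apply/image_rotation_half_planeP; first exact: f_immersion.
rewrite /dihedral_angle; set A := (X in xget 0 X).
have : A (xget 0 A); last by case.
apply: xgetPex; exists t; split=> //.
by apply/image_rotation_half_planeP; first exact: f_immersion.
Qed.

(** The curvature vanishes iff the dihedral angle is 0, i.e. iff no rotation is
    needed to bring one half-plane onto the other. *)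
Lemma mean_curv_edge_eq0P e :
  mean_curv_edge f n e = 0 <-> half_plane (df f e) (n (rface e)) (n (lface e)).
Proof.
have w0 := f_immersion e; have := dihedral_angleP e; rewrite /mean_curv_edge.
have := theta_open e; move: (dihedral_angle f n e) => t t_pi ht; split.
  move/eqP; rewrite 2!mulf_eq0 invr_eq0 pnatr_eq0 (negbTE (enorm_neq0 w0)) /=.
  by move=> /eqP/(tan_half_eq0 t_pi) t0; move: ht; rewrite t0 rotation0.
move=> /half_plane_eqP same; move: ht; rewrite -same => ht.
have /(sin_eq0_small t_pi) -> :=
  sin_rotation_half_plane_eq0 w0 (fun c => (n_not_parallel e c).1) ht.
by rewrite mul0r /tan sin0 mul0r mulr0.
Qed.

Lemma A_minimal_edgeP e :
  dot (n (lface e) + n (rface e)) (df f e) = 0 ->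
  cross (df f e) (n (lface e) - n (rface e)) = 0 <->
  mean_curv_edge f n e = 0.
Proof.
move=> fec; apply: (iff_trans _ (iff_sym (mean_curv_edge_eq0P e))).
apply: cross_sub_eq0_half_planeP => // c.
exact: (n_not_parallel e c).2.
Qed.

End Dihedral.

Section Classical.
Hypothesis faces_planar : planar_with_normals f n.

Lemma dot_df_lface e : dot (df f e) (n (lface e)) = 0.
Proof.
have [_ [p hp]] := faces_planar (lface e).
have h0 := hp (tagged e); have h1 := hp (ordS (tagged e)).
have -> : df f e = (f (corner (ordS (tagged e))) - p) -
    (f (corner (tagged e)) - p) by rewrite opprB addrA subrK.
by rewrite dotC dotDr dotNr ![dot (n _) _]dotC h0 h1 subrr.
Qed.

(** The edge also belongs to the boundary of the other face, with the reversed
    orientation. *)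
Lemma dot_df_rface e : dot (df f e) (n (rface e)) = 0.
Proof.
by have := dot_df_lface (Defs.opp e); rewrite df_opp dotC dotNr dotC => /eqP;
  rewrite oppr_eq0 => /eqP.
Qed.

Lemma planar_face_edge_constraint : face_edge_constraint f n.
Proof.
by move=> e; rewrite dotC dotDr dot_df_lface dot_df_rface addr0.
Qed.

(** Both angles are chosen from the same set: with normals orthogonal to the
    edge, a rotation carries one half-plane to the other iff it carries one
    normal to the other. *)
Lemma normal_angle_dihedral e : normal_angle f n e = dihedral_angle f n e.
Proof.
rewrite /normal_angle /dihedral_angle; congr (xget _ _).
apply/seteqP; split=> t [t_pi ht]; split=> //.
  apply/image_rotation_half_planeP; first exact: f_immersion.
  by apply/rotation_half_plane_orthogonalP => //; [exact: dot_df_lface|exact: dot_df_rface].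
move: ht => /(image_rotation_half_planeP _ _ _ (f_immersion e)).
by move/rotation_half_plane_orthogonalP; apply => //; [exact: dot_df_lface|exact: dot_df_rface].
Qed.

Lemma mean_curv_face_normal_angle i :
  mean_curv_face f n i = 2^-1 * \sum_(k < deg i)
    (let e : oedge X := Tagged (fun i => 'I_(deg i)) k in
     enorm (df f e) * tan (normal_angle f n e / 2)).
Proof.
rewrite /mean_curv_face mulr_sumr; apply: eq_bigr => k _ /=.
by rewrite normal_angle_dihedral mulrA.
Qed.

End Classical.
End Nets.

Theorem theorem3p18 (R : realType) (X : oriented_net)
    (f : vertex X -> 'rV[R]_3) (n : face X -> 'rV[R]_3)
    (f_immersion : immersion f) (n_unit : forall i, enorm (n i) = 1)
    (n_not_parallel : normals_not_parallel f n)
    (theta_open : dihedral_angles_open f n) :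
  (A_minimal f n <->
     (face_edge_constraint f n /\ minimal f n) /\
     forall e : oedge X, mean_curv_edge f n e = 0) /\
  (C_minimal f n <-> classical_net f n /\ minimal f n).
Proof.
have edgeP := A_minimal_edgeP f_immersion n_unit n_not_parallel theta_open.
have half0 (x : R) : (2^-1 * x == 0) = (x == 0).
  by rewrite mulf_eq0 invr_eq0 pnatr_eq0.
split; split.
- move=> A; have H e : mean_curv_edge f n e = 0.
    by have [A1 A2] := A e; apply/edgeP.
  split=> //; split=> [e|i]; first exact: (A e).2.
  by apply: big1 => k _.
- by move=> [[fec _] H] e; split; [apply/edgeP|].
- move=> [planar C]; split; first split=> //.
    exact: planar_face_edge_constraint.
  by move=> i; rewrite mean_curv_face_normal_angle// C mulr0.
- move=> [[_ planar] M]; split=> // i; apply/eqP.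
  by rewrite -half0 -mean_curv_face_normal_angle// M.
Qed.
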